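(* Let $a \ge 2$ be an integer, let $\{p_k\}_{k\ge 1}$ be the sequence of prime numbers, and define $$\mu = \sum_{k=1}^{\infty} \frac{p_k}{a^{k+k!}}.$$ Then $\mu$ is a transcendental number, and it generates the primes by means of $p_1 = \lfloor a^2 \mu \rfloor$ and $$p_n = \lfloor a^{n+n!} \mu \rfloor - a^{1 + n! - (n-1)!} \lfloor a^{(n-1)+(n-1)!} \mu \rfloor \quad \text{for } n=2,3,\dots.$$
   Context: Here $p_k$ denotes the $k$th prime number in increasing order ($p_1=2$, $p_2=3$, $p_3=5$, ...), and $\lfloor x\rfloor$ denotes the integer part (floor) of the real number $x$. A real number is transcendental if it is not a root of any nonzero polynomial with integer coefficients. *)

(* Defs.v *)
From HB Require Import structures.
From mathcomp Require Import all_boot all_order all_algebra.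
From mathcomp Require Import all_classical all_reals all_analysis.

Set Implicit Arguments.
Unset Strict Implicit.
Unset Printing Implicit Defensive.

Import Order.TTheory GRing.Theory Num.Theory.
Import numFieldNormedType.Exports.

Local Open Scope ring_scope.

Lemma ex_prime_above (m : nat) : exists p : nat, (m < p)%N && prime p.
Proof. by have [p mp pp] := prime_above m; exists p; rewrite mp pp. Qed.

Definition next_prime (m : nat) : nat := ex_minn (ex_prime_above m).

(* Indexed from 1: nth_prime 1 = 2, nth_prime 2 = 3, nth_prime 3 = 5.
   The value nth_prime 0 = 0 is only the seed of the iteration. *)
Definition nth_prime (k : nat) : nat := iter k next_prime 0%N.

Definition transcendental (R : realType) (x : R) : Prop :=
  forall P : {poly int}, P != 0 -> ~~ root (map_poly (intr : int -> R) P) x.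

(* Main.v *)
Require Import Defs.
From HB Require Import structures.
From mathcomp Require Import all_boot all_order all_algebra.
From mathcomp Require Import all_classical all_reals all_analysis.
From mathcomp Require Import zify ring lra.

Set Implicit Arguments.
Unset Strict Implicit.
Unset Printing Implicit Defensive.

Import Order.TTheory GRing.Theory Num.Theory.
Import numFieldNormedType.Exports.

Local Open Scope ring_scope.

(** Write D_n = a^(n + n!) and S_n for the sum of the first n terms of the
    series, so that D_n S_n is an integer.  Everything follows from the size
    of the tail mu - S_n, and that only needs a crude bound on the primes:
    Euclid's argument gives p_(n+1) + 1 <= 2^(n + n!) <= D_n for n >= 1
    (nth_primeS_bound).  Since the exponents n + n! at least double at each
    step, D_n^2 <= D_(n+1), hence

      S_(n+1) + 1/D_(n+1) = S_n + (p_(n+1) + 1)/D_(n+1)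
                          <= S_n + D_n/D_(n+1) <= S_n + 1/D_n.

    Thus mu is squeezed between the increasing sums S_n and the decreasing
    sums S_n + 1/D_n (prime_series_bounds).

    Consequently the floor of D_n mu is the integer D_n S_n
    (floor_denom_series), and the formula for p_n reads off the last term of
    the recurrence D_n S_n = (D_n/D_(n-1)) D_(n-1) S_(n-1) + p_n.

    The same chain gives 0 < mu - S_n < D_n/D_(n+1).  As D_(n+1) eventually
    exceeds every fixed power of D_n, the rationals S_n make mu a Liouville
    number (prime_series_liouville), and Liouville numbers are transcendental
    (liouville_transcendental): near a root x of an integer polynomial P, the
    value |P(A/B)| at a fraction A/B other than x is nonzero and at most a
    constant times |x - A/B|, whereas a nonzero value of P at A/B is at least
    1/B^deg P in absolute value. *)

(** * Euclid's bound on the primes *)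

Lemma nth_primeS (k : nat) : nth_prime k.+1 = next_prime (nth_prime k).
Proof. by []. Qed.

Lemma nth_prime_prime (k : nat) : prime (nth_prime k.+1).
Proof. by rewrite nth_primeS /next_prime; case: ex_minnP => p /andP[]. Qed.

Lemma nth_primeS_le (k r : nat) :
  (nth_prime k < r)%N -> prime r -> (nth_prime k.+1 <= r)%N.
Proof.
move=> ltr pr; rewrite nth_primeS /next_prime.
by case: ex_minnP => p _; apply; rewrite ltr.
Qed.

Lemma prime_dvd_primorial (k r : nat) :
  prime r -> (r <= nth_prime k)%N ->
  (r %| \prod_(j < k) nth_prime j.+1)%N.
Proof.
move=> pr; elim: k => [|k IHk] le_r.
  by move: le_r; rewrite leqn0 => /eqP r0; rewrite r0 in pr.
rewrite big_ord_recr; have [le_rk|lt_kr] := leqP r (nth_prime k).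
  by rewrite dvdn_mulr ?IHk.
suff -> : nth_prime k.+1 = r by rewrite dvdn_mull.
by apply/eqP; rewrite eqn_leq le_r nth_primeS_le.
Qed.

(** Euclid's argument: a prime factor of p_1 ... p_k + 1 divides no p_j with
    j <= k, so it exceeds p_k. *)
Lemma nth_primeS_le_primorial (k : nat) :
  (nth_prime k.+1 <= (\prod_(j < k) nth_prime j.+1).+1)%N.
Proof.
set Q := (\prod_(j < k) _)%N.
have Q_gt0 : (0 < Q)%N.
  by rewrite prodn_gt0 // => j; rewrite prime_gt0 ?nth_prime_prime.
have := pdiv_dvd Q.+1; have := pdiv_leq (ltn0Sn Q).
have : prime (pdiv Q.+1) by rewrite pdiv_prime.
move: (pdiv _) => r pr leQ dvdQ1; apply: leq_trans leQ.
apply: nth_primeS_le => //; rewrite ltnNge; apply/negP => le_r.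
have dvdQ : (r %| Q)%N := prime_dvd_primorial pr le_r.
move: dvdQ1; rewrite -addn1 dvdn_addr // dvdn1 => /eqP r1.
by rewrite r1 in pr.
Qed.

(** The exponent k + k! is the one of a in the denominators of the series.  It
    suits an induction by squaring: Q p <= Q (Q + 1) for the primorial Q, and
    the exponent at least doubles from k to k + 1.  The summand 2 makes the
    bound stable, as Q (Q + 1) + 2 <= (Q + 2)^2; it is an equality at the first
    step, 2 + 2 = 2^2. *)
Lemma primorial_lt (k : nat) :
  (\prod_(j < k.+1) nth_prime j.+1 + 2 <= 2 ^ (k.+1 + k.+1`!))%N.
Proof.
elim: k => [|k IHk].
  rewrite big_ord1 -[leqRHS]/(2 + 2)%N leq_add2r.
  exact: (@nth_primeS_le 0).
rewrite big_ord_recr; have := nth_primeS_le_primorial k.+1.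
move: IHk; set Q := (\prod_(j < _) _)%N => IHk le_p.
have le_sq : (Q * nth_prime k.+2 + 2 <= (Q + 2) * (Q + 2))%N by nia.
apply: (leq_trans le_sq); apply: (leq_trans (leq_mul IHk IHk)).
rewrite -expnD leq_exp2l // [k.+2`!]factS.
by have := fact_gt0 k.+1; nia.
Qed.

Lemma nth_primeS_bound (k : nat) :
  (0 < k)%N -> (nth_prime k.+1 + 1 <= 2 ^ (k + k`!))%N.
Proof.
case: k => // k _; apply: leq_trans (primorial_lt k).
by have := nth_primeS_le_primorial k.+1; lia.
Qed.

(** * Liouville numbers are transcendental *)

(** Factoring P = Q (X - x)^m with Q(x) nonzero gives both bounds at once: near
    x, |Q| stays in ]0, 2 |Q(x)|].  The lower bound, which says that the root is
    isolated, spares a reduction to irreducible polynomials. *)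
Lemma poly_near_root (R : realType) (P : {poly R}) (x : R) :
  P != 0 -> root P x ->
  exists C e : R, [/\ 0 < C, 0 < e &
    forall y, 0 < `|x - y| < e -> 0 < `|P.[y]| <= C * `|x - y|].
Proof.
move=> P0 rootP; have [m [Q]] := multiplicity_XsubC P x.
rewrite P0 /= => Qx defP.
have m_gt0 : (0 < m)%N.
  by case: m defP rootP => // ->; rewrite expr0 mulr1 (negPf Qx).
have Qx0 : 0 < `|Q.[x]| by rewrite normr_gt0.
have /cvgrPdist_lt/(_ _ Qx0) := @continuous_horner R Q x.
case=> e /= e_gt0 near_x.
exists (2 * `|Q.[x]|), (Num.min e 1); split.
- by rewrite mulr_gt0.
- by rewrite lt_min e_gt0 ltr01.
move=> y /andP[xy_gt0]; rewrite lt_min => /andP[xy_e xy_1].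
have Qxy : `|Q.[x] - Q.[y]| < `|Q.[x]| by exact: near_x.
have Qy_gt0 : 0 < `|Q.[y]|.
  by rewrite normr_gt0; apply: contraTneq Qxy => ->; rewrite subr0 ltxx.
have Qy_le : `|Q.[y]| <= 2 * `|Q.[x]|.
  have := ler_normB Q.[x] (Q.[x] - Q.[y]).
  by rewrite opprB addrC subrK => ?; lra.
rewrite defP hornerM horner_exp hornerXsubC normrM normrX distrC.
rewrite mulr_gt0 ?exprn_gt0 //= ler_pM ?exprn_ge0 //.
by rewrite -[leRHS]expr1 ler_wiXn2l // ltW.
Qed.

Lemma horner_clear_denominator (R : numFieldType) (P : {poly int}) (A B : int) :
  B != 0 ->
  exists N : int, (map_poly intr P).[A%:~R / B%:~R] * B%:~R ^+ size P
                  = N%:~R :> R.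
Proof.
move=> B0; exists (\sum_(i < size P) P`_i * A ^+ i * B ^+ (size P - i)).
rewrite (@horner_coef_wide _ (size P)) ?size_poly //.
rewrite mulr_suml rmorph_sum; apply: eq_bigr => i _ /=.
rewrite coef_map /= !intrM !rmorphXn /= expr_div_n -!mulrA; congr (_ * (_ * _)).
have -> : B%:~R ^+ size P = B%:~R ^+ i * B%:~R ^+ (size P - i) :> R.
  by rewrite -exprD subnKC // ltnW.
rewrite mulKf //.
by rewrite expf_neq0 // intr_eq0.
Qed.

Definition liouville (R : realType) (x : R) : Prop :=
  forall d : nat, exists A B : int,
    1 < B /\ 0 < `|x - A%:~R / B%:~R| < (B%:~R ^+ d)^-1.

Lemma liouville_transcendental (R : realType) (x : R) :
  liouville x -> transcendental x.
Proof.
move=> liou P P0; apply/negP => rootP.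
have PR0 : map_poly (intr : int -> R) P != 0.
  by rewrite map_poly_eq0_id0 // intr_eq0 lead_coef_eq0.
have [C [e [C_gt0 e_gt0 near_x]]] := poly_near_root PR0 rootP.
pose t := Num.truncn (Num.max C e^-1).
have ltt : Num.max C e^-1 < 2 ^+ t.+1.
  apply: lt_trans (truncnS_gt _) _.
  by rewrite -natrX ltr_nat; apply: ltn_expl.
(* Of the exponent size P + t + 1, the part size P clears the denominators of
   P(A/B), and t + 1 makes B^(t+1) >= 2^(t+1) beat both constants. *)
have [A [B [B_gt1 /andP[dist_gt0 dist_lt]]]] := liou (size P + t.+1)%N.
have BR2 : (2 : R) <= B%:~R by rewrite -[2]/(2%:~R) ler_int.
have BR_gt0 : (0 : R) < B%:~R by lra.
have powB : Num.max C e^-1 < B%:~R ^+ t.+1.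
  by apply: lt_le_trans ltt _; rewrite lerXn2r ?nnegrE; lra.
move: powB; rewrite gt_max => /andP[C_lt e_lt].
have powB_ge1 : 1 <= B%:~R ^+ size P :> R.
  by rewrite exprn_ege1 //; lra.
have powB_gt0 : 0 < B%:~R ^+ t.+1 :> R by rewrite exprn_gt0.
move: dist_lt; rewrite exprD invfM => dist_lt.
have dist_e : `|x - A%:~R / B%:~R| < e.
  apply: lt_le_trans dist_lt _.
  apply: (@le_trans _ _ (B%:~R ^- t.+1)).
    by rewrite ler_piMl ?invr_ge0 ?(ltW powB_gt0) // invf_le1 ?exprn_gt0.
  by rewrite -(invrK e) lef_pV2 ?posrE ?invr_gt0 // ltW.
have := near_x (A%:~R / B%:~R); rewrite dist_gt0 dist_e => /(_ isT).
move=> /andP[Py_gt0 Py_le].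
have [|N defN] := @horner_clear_denominator R P A B.
  by rewrite gt_eqF // (lt_trans ltr01).
(* The integer N = P(A/B) B^(size P) is too small to be nonzero. *)
have N_lt1 : `|N%:~R| < 1 :> R.
  rewrite -defN normrM (ger0_norm (exprn_ge0 _ (ltW BR_gt0))).
  rewrite -ltr_pdivlMr ?exprn_gt0 // mul1r.
  apply: le_lt_trans Py_le _.
  have : C * `|x - A%:~R / B%:~R| <
      C * ((B%:~R ^+ size P)^-1 / B%:~R ^+ t.+1) by rewrite ltr_pM2l.
  move/lt_trans; apply; rewrite mulrCA -[ltRHS]mulr1 ltr_pM2l.
    by rewrite ltr_pdivrMr // mul1r.
  by rewrite invr_gt0 exprn_gt0.
have N_neq0 : N != 0.
  rewrite -(intr_eq0 R) -defN mulf_neq0 ?expf_neq0 //.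
    by rewrite -normr_gt0.
  by rewrite gt_eqF.
by move: N_lt1; rewrite -intr_norm ltrz1 ltNge -gtz0_ge1 normr_gt0 N_neq0.
Qed.

(** * Bounds on the partial sums *)

Definition denom (a : int) (n : nat) : int := a ^+ (n + n`!).

(** The numerator of the n-th partial sum over denom a n, defined by recurrence
    rather than as a sum because this recurrence is the formula for the primes. *)
Fixpoint numer (a : int) (n : nat) : int :=
  if n is m.+1 then
    a ^+ (1 + n`! - m`!) * numer a m + (nth_prime n)%:Z
  else 0.

Lemma numerS (a : int) (n : nat) :
  numer a n.+1 =
  a ^+ (1 + n.+1`! - n`!) * numer a n + (nth_prime n.+1)%:Z.
Proof. by []. Qed.

Definition partial_sum (R : realType) (a : int) (n : nat) : R :=
  (numer a n)%:~R / (denom a n)%:~R.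

Lemma denom_gt0 (R : realType) (a : int) (n : nat) :
  2 <= a -> 0 < (denom a n)%:~R :> R.
Proof. by move=> a2; rewrite ltr0z exprn_gt0 // (lt_le_trans _ a2). Qed.

Lemma denomS (a : int) (n : nat) :
  denom a n.+1 = a ^+ (1 + n.+1`! - n`!) * denom a n.
Proof.
rewrite /denom -exprD; congr (_ ^+ _).
by rewrite factS; have := fact_gt0 n; nia.
Qed.

Lemma denom_pow_le (a : int) (d n : nat) :
  2 <= a -> (d * (n + n`!) <= n.+1 + n.+1`!)%N ->
  denom a n ^+ d <= denom a n.+1.
Proof.
move=> a2 le_dn; rewrite /denom -exprM ler_weXn2l 1?mulnC //.
exact: le_trans a2.
Qed.

Lemma denom_sqr_le (a : int) (n : nat) :
  2 <= a -> (0 < n)%N -> denom a n ^+ 2 <= denom a n.+1.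
Proof.
move=> a2 n_gt0; apply: denom_pow_le => //.
by rewrite factS; have := fact_gt0 n; nia.
Qed.

(** Strictness fails for n = 1, where a^(1 + 1!) squared is a^(2 + 2!). *)
Lemma denom_sqr_lt (a : int) (n : nat) :
  2 <= a -> (1 < n)%N -> denom a n ^+ 2 < denom a n.+1.
Proof.
move=> a2 n_gt1; rewrite /denom -exprM ltr_eXn2l; last exact: lt_le_trans a2.
have n_fact : (n <= n`!)%N by exact: fact_geq.
by rewrite factS; nia.
Qed.

Lemma nth_primeS_lt_denom (a : int) (n : nat) :
  2 <= a -> (0 < n)%N -> (nth_prime n.+1)%:Z + 1 <= denom a n.
Proof.
move=> a2 n_gt0; apply: (@le_trans _ _ ((2 ^ (n + n`!))%N%:Z)).
  by rewrite -[1]/(1%N%:Z) -PoszD lez_nat nth_primeS_bound.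
by rewrite /denom -natz natrX lerXn2r // nnegrE (le_trans _ a2).
Qed.

Lemma partial_sumS (R : realType) (a : int) (n : nat) :
  2 <= a ->
  partial_sum R a n.+1 =
  partial_sum R a n + (nth_prime n.+1)%:R / (denom a n.+1)%:~R.
Proof.
move=> a2; rewrite /partial_sum denomS numerS.
set t := a ^+ _; have t0 : t%:~R != 0 :> R.
  by rewrite intr_eq0 expf_neq0 // gt_eqF // (lt_le_trans _ a2).
have D0 := lt0r_neq0 (denom_gt0 R n a2).
rewrite intrD !intrM -pmulrn.
by field; apply/andP; split.
Qed.

Definition prime_series (R : realType) (a : int) : R :=
  \big[+%R/0]_(1 <= k <oo) ((nth_prime k)%:R / a%:~R ^+ (k + k`!) : R).

Lemma partial_sumE (R : realType) (a : int) (n : nat) :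
  2 <= a ->
  \sum_(1 <= k < n) ((nth_prime k)%:R / a%:~R ^+ (k + k`!) : R) =
  partial_sum R a n.-1.
Proof.
move=> a2; case: n => [|n]; first by rewrite big_geq // /partial_sum mul0r.
elim: n => [|n IHn]; first by rewrite big_geq // /partial_sum mul0r.
by rewrite big_nat_recr //= IHn partial_sumS // /denom rmorphXn.
Qed.

Lemma partial_sum_lt (R : realType) (a : int) (n : nat) :
  2 <= a -> partial_sum R a n < partial_sum R a n.+1.
Proof.
move=> a2; rewrite partial_sumS // ltrDl divr_gt0 ?denom_gt0 //.
by rewrite ltr0n prime_gt0 // nth_prime_prime.
Qed.

Definition upper_sum (R : realType) (a : int) (n : nat) : R :=
  partial_sum R a n + (denom a n)%:~R^-1.

(** The bound p_(n+1) + 1 <= D_n absorbs at once the new term p_(n+1)/D_(n+1)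
    and the correction 1/D_(n+1). *)
Lemma upper_sumS_le_gap (R : realType) (a : int) (n : nat) :
  2 <= a -> (0 < n)%N ->
  upper_sum R a n.+1
    <= partial_sum R a n + (denom a n)%:~R / (denom a n.+1)%:~R.
Proof.
move=> a2 n_gt0; rewrite /upper_sum partial_sumS // -addrA lerD2l.
rewrite -[X in _ + X]mul1r -mulrDl ler_pM2r ?invr_gt0 ?denom_gt0 //.
have := nth_primeS_lt_denom a2 n_gt0.
by rewrite -(ler_int R) rmorphD.
Qed.

Lemma upper_sumS_le (R : realType) (a : int) (n : nat) :
  2 <= a -> (0 < n)%N -> upper_sum R a n.+1 <= upper_sum R a n.
Proof.
move=> a2 n_gt0; apply: le_trans (upper_sumS_le_gap R a2 n_gt0) _.
rewrite lerD2l ler_pdivrMr ?denom_gt0 // mulrC ler_pdivlMr ?denom_gt0 //.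
by rewrite -intrM ler_int -expr2 denom_sqr_le.
Qed.

Lemma upper_sumS_lt (R : realType) (a : int) (n : nat) :
  2 <= a -> (1 < n)%N -> upper_sum R a n.+1 < upper_sum R a n.
Proof.
move=> a2 n_gt1; apply: le_lt_trans (upper_sumS_le_gap R a2 (ltnW n_gt1)) _.
rewrite ltrD2l ltr_pdivrMr ?denom_gt0 // mulrC ltr_pdivlMr ?denom_gt0 //.
by rewrite -intrM ltr_int -expr2 denom_sqr_lt.
Qed.

Lemma upper_sum_le (R : realType) (a : int) (m n : nat) :
  2 <= a -> (0 < m)%N -> (m <= n)%N -> upper_sum R a n <= upper_sum R a m.
Proof.
move=> a2 m_gt0 /subnK <-; elim: (n - m)%N => // k IHk.
by apply: le_trans IHk; rewrite addSn upper_sumS_le // addn_gt0 m_gt0 orbT.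
Qed.

(** The strict upper bound at n = 1 is what makes the first floor equal to 2;
    it is inherited from later indices, since the upper sums decrease strictly
    from n = 2 on. *)
Lemma prime_series_bounds (R : realType) (a : int) (n : nat) :
  2 <= a -> (0 < n)%N ->
  partial_sum R a n < prime_series R a < upper_sum R a n.
Proof.
move=> a2 n_gt0.
pose u k := partial_sum R a k.-1.
have -> : prime_series R a = limn u.
  by congr (limn _); apply/funext => k; rewrite partial_sumE.
have nd_u : {homo u : k l / (k <= l)%N >-> k <= l}.
  apply: homo_leq (@lexx _ _) (@le_trans _ _) _ => k.
  by case: k => // k; rewrite /u /= ltW // partial_sum_lt.
have u_le m : (0 < m)%N -> forall k, u k <= upper_sum R a m.
  move=> m_gt0 k; apply: le_trans (nd_u _ _ (leq_maxr m.+1 k)) _.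
  rewrite /u /=; have -> : (maxn m.+1 k).-1 = maxn m k.-1 by lia.
  apply: le_trans (upper_sum_le R a2 m_gt0 (leq_maxl m k.-1)).
  by rewrite lerDl invr_ge0 ltW // denom_gt0.
have cvg_u : cvgn u.
  apply: nondecreasing_is_cvgn => //.
  by exists (upper_sum R a 1) => _ [k _ <-]; exact: u_le.
apply/andP; split.
  apply: lt_le_trans (partial_sum_lt R n a2) _.
  by have := nondecreasing_cvgn_le nd_u cvg_u n.+2.
(* Two steps are needed: the decrease from n to n + 1 may be an equality. *)
apply: le_lt_trans (_ : upper_sum R a n.+2 < _).
  by apply: limr_le => //; apply: nearW => k; exact: u_le.
apply: lt_le_trans (upper_sumS_le R a2 n_gt0).
exact: upper_sumS_lt.
Qed.

(** * Transcendence and the floor formula *)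

Lemma prime_series_liouville (R : realType) (a : int) :
  2 <= a -> liouville (prime_series R a).
Proof.
(* The choice of n ensures (d + 1)(n + n!) <= 2 (d + 1) n! <= (n + 1)!, that is
   D_n^(d+1) <= D_(n+1). *)
move=> a2 d; pose n := (2 * d + 2)%N.
have n_gt0 : (0 < n)%N by rewrite /n addn2.
exists (numer a n), (denom a n).
have := prime_series_bounds R a2 n_gt0.
have := prime_series_bounds R a2 (ltn0Sn n).
set mu := prime_series R a => /andP[_ mu_lt] /andP[mu_gt _].
have D_gt0 := denom_gt0 R n a2.
split.
  by rewrite exprn_egt1 ?(lt_le_trans _ a2) // addn_eq0 /n addn2.
rewrite -/(partial_sum R a n) gtr0_norm ?subr_gt0 // mu_gt /= ltrBlDl.
apply: lt_le_trans mu_lt _; apply: le_trans (upper_sumS_le_gap R a2 n_gt0) _.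
rewrite lerD2l ler_pdivrMr ?denom_gt0 // mulrC ler_pdivlMr ?exprn_gt0 //.
rewrite -exprS -rmorphXn ler_int denom_pow_le //.
have n_fact : (n <= n`!)%N by exact: fact_geq.
by rewrite factS; move: n_fact; rewrite /n; nia.
Qed.

Lemma floor_denom_series (R : realType) (a : int) (n : nat) :
  2 <= a -> (0 < n)%N ->
  Num.floor (a%:~R ^+ (n + n`!) * prime_series R a) = numer a n.
Proof.
move=> a2 n_gt0; have := prime_series_bounds R a2 n_gt0.
set mu := prime_series R a; have D_gt0 := denom_gt0 R n a2.
rewrite /upper_sum /partial_sum -[X in _ + X]mul1r -mulrDl.
rewrite ltr_pdivrMr // ltr_pdivlMr // => /andP[mu_gt mu_lt].
apply: floor_def; rewrite -rmorphXn -/(denom a n) mulrC (ltW mu_gt) /=.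
by rewrite rmorphD.
Qed.

Theorem theorem1 (R : realType) (a : int) (ha : 2 <= a) :
  let mu : R :=
    \big[+%R/0]_(1 <= k <oo) ((nth_prime k)%:R / a%:~R ^+ (k + k`!) : R) in
  [/\ transcendental mu,
      (nth_prime 1)%:Z = Num.floor (a%:~R ^+ 2 * mu) &
      forall n : nat, (2 <= n)%N ->
        (nth_prime n)%:Z =
          Num.floor (a%:~R ^+ (n + n`!) * mu)
          - a ^+ (1 + n`! - (n - 1)`!)
            * Num.floor (a%:~R ^+ ((n - 1) + (n - 1)`!) * mu)].
Proof.
rewrite -/(prime_series R a) => mu; split.
- exact/liouville_transcendental/prime_series_liouville.
- by rewrite (@floor_denom_series R a 1) //= mulr0 add0r.
case=> [|[|n]] // _; rewrite subn1 [n.+2.-1]/=.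
by rewrite !floor_denom_series // (numerS a n.+1) addrAC subrr add0r.
Qed.
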